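(* Let $I=(U,R)$ be an approximation space (a non-empty finite set $U$ with an equivalence relation $R$ on $U$), and let $(T,\Delta,\nabla)$ be its rough semiring. Then for every $RS(X)\in T$, the dual pseudocomplement of $RS(X)$ is unique; that is, there is exactly one element of $T$ which is a dual pseudocomplement of $RS(X)$.
   Context: Setting. $U$ is a non-empty finite set, $R$ an equivalence relation on $U$, $[x]_R$ the class of $x$. For $X\subseteq U$ put $R_{-}(X)=\{x\in U: [x]_R\subseteq X\}$, $R^{-}(X)=\{x\in U: [x]_R\cap X\neq\emptyset\}$. The rough set of $X$ is $RS(X)=(R_{-}(X),R^{-}(X))$, and $T=\{RS(X): X\subseteq U\}$. $T$ is ordered componentwise: $RS(X)\le RS(Y)$ iff $R_{-}(X)\subseteq R_{-}(Y)$ and $R^{-}(X)\subseteq R^{-}(Y)$. Operations on subsets of $U$. Let $IW(X)$ be the number of equivalence classes contained in $X$. Praba join: if $IW(X\cup Y)=IW(X)+IW(Y)-IW(X\cap Y)$ then $X\Delta Y=X\cup Y$. If $IW(X\cup Y)>IW(X)+IW(Y)-IW(X\cap Y)$, one identifies an equivalence class newly formed by the union (contained in $X\cup Y$ but in neither $X$ nor $Y$), deletes from $Y$ its elements belonging to that class, calls the result $Y$ again, and repeats until equality holds; then $X\Delta Y$ is the union of $X$ and the final $Y$. Praba meet: $x$ is a pivot element of $X,Y$ if $[x]_R\not\subseteq X\cap Y$, $[x]_R\cap X\ne\emptyset$ and $[x]_R\cap Y\neq\emptyset$; the pivot set $P_{X\cap Y}$ consists of one representative pivot element for each such class; $X\nabla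 Y=\{x\in U:[x]_R\subseteq X\cap Y\}\cup P_{X\cap Y}$. Operations on $T$. $RS(X)\Delta RS(Y)=RS(X\Delta Y)$ and $RS(X)\nabla RS(Y)=RS(X\nabla Y)$; it is known that these are respectively the least upper bound and the greatest lower bound of $RS(X),RS(Y)$ in $T$, and that $(T,\Delta,\nabla)$ is a semiring, called the rough semiring. $RS(\emptyset)$ and $RS(U)$ are the least and greatest elements of $T$. Definition. A dual pseudocomplement of $RS(X)\in T$ is a least element, denoted $RS(X)^{+}$, of the set $\{RS(Y)\in T: RS(X)\Delta RS(Y)=RS(U)\}$. *)

(* Defs.v *)
From HB Require Import structures.
From mathcomp Require Import all_boot order ssralg.

Set Implicit Arguments.
Unset Strict Implicit.
Unset Printing Implicit Defensive.

Import Order.TTheory.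

Section PrabaOperations.
Variables (U : finType) (R : equiv_rel U).
Implicit Types (x y : U) (X Y Z C D P : {set U}).

Definition eclass x : {set U} := [set y | R x y].
Definition classes : {set {set U}} := [set eclass x | x : U].

Definition lower X : {set U} := [set x | eclass x \subset X].
Definition upper X : {set U} := [set x | eclass x :&: X != set0].
Definition approx X : {set U} * {set U} := (lower X, upper X).

Definition IW X : nat := #|[set C in classes | C \subset X]|.

Definition new_classes X Y : {set {set U}} :=
  [set C in classes | [&& C \subset X :|: Y, ~~ (C \subset X)
                                           & ~~ (C \subset Y)]].

Definition praba_step X Y : {set U} :=
  if IW X + IW Y - IW (X :&: Y) < IW (X :|: Y) then
    if [pick C in new_classes X Y] is Some C then Y :\: C else Y
  else Y.

(* #|classes| passes always suffice, and the class that each pass deletes may *)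
(* be chosen arbitrarily: see praba_joinP.                                    *)
Definition praba_join X Y : {set U} :=
  X :|: iter #|classes| (praba_step X) Y.

(* The same procedure as a nondeterministic process: praba_run X Y Z says     *)
(* that some sequence of choices of newly formed classes ends with value Z.   *)
Inductive praba_run X : {set U} -> {set U} -> Prop :=
| praba_stop Y of IW (X :|: Y) = IW X + IW Y - IW (X :&: Y) :
    praba_run X Y (X :|: Y)
| praba_delete Y C Z of IW X + IW Y - IW (X :&: Y) < IW (X :|: Y)
    & C \in new_classes X Y & praba_run X (Y :\: C) Z : praba_run X Y Z.

Definition pivots X Y : {set U} :=
  [set x | [&& ~~ (eclass x \subset X :&: Y), eclass x :&: X != set0
             & eclass x :&: Y != set0]].

(* One representative of each class of pivots; the choice is immaterial for   *)
(* the rough set of the meet: see approx_praba_meet.                          *)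
Definition pivot_set X Y : {set U} :=
  transversal (equivalence_partition R (pivots X Y)) (pivots X Y).

Definition praba_meet X Y : {set U} := lower (X :&: Y) :|: pivot_set X Y.

Lemma eclass_refl x : x \in eclass x.
Proof. by rewrite inE. Qed.

Lemma eclass_eq x y : y \in eclass x -> eclass y = eclass x.
Proof.
by rewrite inE => Rxy; apply/setP=> z; rewrite !inE (equiv_ltrans Rxy).
Qed.

Lemma classes_eqE C D x :
  C \in classes -> D \in classes -> x \in C -> x \in D -> C = D.
Proof.
case/imsetP=> c _ -> /imsetP[d _ ->] /eclass_eq <- /eclass_eq <- //.
Qed.

Lemma IW_sub X Y : X \subset Y -> IW X <= IW Y.
Proof.
move=> sXY; apply/subset_leq_card/subsetP=> C; rewrite !inE => /andP[-> sCX].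
exact: subset_trans sXY.
Qed.

Lemma IW_setU X Y :
  IW (X :|: Y) = IW X + IW Y - IW (X :&: Y) + #|new_classes X Y|.
Proof.
pose c X := [set C in classes | C \subset X].
have -> : IW (X :|: Y) = #|(c X :|: c Y) :|: new_classes X Y|.
  apply: eq_card => C; rewrite !inE; case: (C \in classes) => //=.
  case sX: (C \subset X); first by rewrite (subset_trans sX) ?subsetUl.
  case sY: (C \subset Y); first by rewrite (subset_trans sY) ?subsetUr.
  by rewrite andbT.
rewrite cardsU (_ : _ :&: new_classes X Y = set0) ?cards0 ?subn0; last first.
  by apply/setP=> C; rewrite !inE; case: (C \in _) (C \subset X) (C \subset Y)
    => [] [] [] //=; rewrite ?andbF.
congr (_ + _); rewrite cardsU; congr (_ - _); apply: eq_card => C.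
by rewrite !inE subsetI; case: (C \in classes).
Qed.

Lemma praba_ltE X Y :
  (IW X + IW Y - IW (X :&: Y) < IW (X :|: Y)) = (new_classes X Y != set0).
Proof. by rewrite IW_setU -[X in X < _]addn0 ltn_add2l card_gt0. Qed.

Lemma new_classesD X Y C : C \in new_classes X Y ->
  new_classes X (Y :\: C) = new_classes X Y :\ C.
Proof.
rewrite inE => /and4P[clC sC nCX nCY]; apply/setP=> D.
rewrite !inE; case clD: (D \in classes); last by rewrite andbF.
rewrite /=; case: eqP => [->|neqDC] /=.
  apply/negP=> /and3P[/subsetP s _ _]; case/negP: nCX; apply/subsetP=> x Cx.
  by have := s _ Cx; rewrite !inE Cx orbF.
have dis: D :\: C = D.
  apply/setDidPl; rewrite -setI_eq0; apply/eqP/setP=> x; rewrite !inE.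
  by apply/negP=> /andP[xD xC]; apply: neqDC; apply: (classes_eqE clD clC xD).
have nC x : x \in D -> x \notin C by rewrite -{1}dis inE => /andP[].
have -> : (D \subset Y :\: C) = (D \subset Y).
  apply/subsetP/subsetP=> s x Dx.
    by have := s x Dx; rewrite inE => /andP[].
  by rewrite inE nC ?s.
congr (_ && _); apply/subsetP/subsetP=> s x Dx; have := s x Dx; rewrite !inE.
  by case/orP=> [->|/andP[_ ->]] //; rewrite orbT.
by rewrite nC.
Qed.

Lemma praba_runE X Y Z :
  praba_run X Y Z -> Z = X :|: (Y :\: cover (new_classes X Y)).
Proof.
elim=> {Y Z} [Y eqIW | Y C Z ltIW CN _ ->].
  have /eqP -> : new_classes X Y == set0.
    by rewrite -[_ == _]negbK -praba_ltE eqIW ltnn.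
  by rewrite /cover big_set0 setD0.
rewrite new_classesD // setDDl; congr (_ :|: (_ :\: _)).
by rewrite /cover [RHS](big_setD1 C).
Qed.

Lemma praba_run_join X Y : praba_run X Y (praba_join X Y).
Proof.
rewrite /praba_join; have: #|new_classes X Y| <= #|classes|.
  by apply/subset_leq_card/subsetP=> C; rewrite inE => /andP[].
elim: #|classes| Y => [|n IHn] Y leN.
  apply: praba_stop; rewrite IW_setU; move: leN; rewrite leqn0 => /eqP ->.
  by rewrite addn0.
rewrite iterSr {2}/praba_step; case: ifP => ltIW.
  case: pickP => [C CN | N0].
    apply: (praba_delete ltIW CN); apply: IHn.
    by rewrite new_classesD //; rewrite (cardsD1 C) CN in leN.
  by move: ltIW; rewrite praba_ltE => /set0Pn[C]; rewrite N0.
apply: IHn; move/negbT: ltIW; rewrite praba_ltE negbK => /eqP ->.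
by rewrite cards0.
Qed.

Lemma praba_joinP X Y Z : praba_run X Y Z <-> Z = praba_join X Y.
Proof.
split=> [/praba_runE -> | ->]; last exact: praba_run_join.
by rewrite -(praba_runE (praba_run_join X Y)).
Qed.

Lemma lowerP X x : reflect (forall y, R x y -> y \in X) (x \in lower X).
Proof.
rewrite inE; apply: (iffP subsetP) => s y.
  by move=> Rxy; apply/s; rewrite inE.
by rewrite inE; apply: s.
Qed.

Lemma upperP X x : reflect (exists2 y, R x y & y \in X) (x \in upper X).
Proof.
rewrite in_set; apply: (iffP (set0Pn _)) => [[y]|[y Rxy Xy]].
  by rewrite !inE => /andP[]; exists y.
by exists y; rewrite !inE Rxy.
Qed.

Lemma approx_praba_join X Y :
  approx (praba_join X Y) = (lower X :|: lower Y, upper X :|: upper Y).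
Proof.
rewrite (praba_runE (praba_run_join X Y)).
set N := cover _.
have NP x : reflect (eclass x \in new_classes X Y) (x \in N).
  apply: (iffP bigcupP) => [[C CN xC]|xN]; last first.
    by exists (eclass x); rewrite ?eclass_refl.
  suff -> : eclass x = C by [].
  apply: (@classes_eqE _ _ x); rewrite ?eclass_refl ?imset_f //.
  by move: CN; rewrite inE => /andP[].
have NR x y : R x y -> (y \in N) = (x \in N).
  by move=> Rxy; apply/NP/NP; rewrite (@eclass_eq x y) // inE.
congr (_, _); apply/setP=> x; apply/idP/idP.
- move=> sZ; rewrite inE; case xN: (x \in N).
    move/NP: (xN); rewrite inE => /and4P[_ _ nX _].
    case/negP: nX; apply/subsetP=> y; rewrite inE => Rxy.
    by have := lowerP _ _ sZ y Rxy; rewrite !inE (NR _ _ Rxy) xN /= orbF.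
  move/NP: xN; rewrite inE imset_f //= => /negP; rewrite !negb_and !negbK.
  rewrite !inE => /orP[|//].
  case/negP; apply/subsetP=> y; rewrite inE => Rxy.
  have := lowerP _ _ sZ y Rxy; rewrite !inE.
  by case/orP=> [->|/andP[_ ->]] //; rewrite orbT.
- rewrite inE; case/orP=> sX; apply/lowerP=> y Rxy.
    by rewrite !inE (lowerP _ _ sX y Rxy).
  rewrite !inE (lowerP _ _ sX y Rxy) (NR _ _ Rxy) andbT.
  case xN: (x \in N); last by rewrite orbT.
  by move/NP: xN sX; rewrite !inE => /and4P[_ _ _ /negPf ->].
- case/upperP=> y Rxy; rewrite !in_setU in_setD => /orP[yX|/andP[_ yY]].
    by apply/orP; left; apply/upperP; exists y.
  by apply/orP; right; apply/upperP; exists y.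
- rewrite in_setU; case/orP=> /upperP[y Rxy yX].
    by apply/upperP; exists y; rewrite // !inE yX.
  case xN: (x \in N); last first.
    by apply/upperP; exists y; rewrite // !inE yX (NR _ _ Rxy) xN orbT.
  move/NP: xN; rewrite inE => /and4P[_ /subsetP s _ /subsetPn[z]].
  rewrite inE => Rxz nYz; apply/upperP; exists z => //.
  have := s z; rewrite !inE => /(_ Rxz); rewrite (negPf nYz) orbF => -> //.
Qed.

Lemma transversal_equivP D P : is_transversal P (equivalence_partition R D) D ->
  [/\ P \subset D, forall x, x \in D -> exists2 y, y \in P & R x y
    & {in P &, forall x y, R x y -> x = y}].
Proof.
case/and3P=> _ sP /forall_inP trP; split=> // [x xD | x y xP yP Rxy].
  have /trP/cards1P[y /setP/(_ y)] : [set y in D | R x y] \in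
    equivalence_partition R D by apply: imset_f.
  by rewrite !inE eqxx => /and3P[]; exists y.
have /trP/cards1P[z /setP eqz] : [set y in D | R x y] \in
    equivalence_partition R D by rewrite imset_f ?(subsetP sP).
have := eqz x; have := eqz y; rewrite !inE xP yP.
rewrite !(subsetP sP _ _) // Rxy equiv_refl /=.
by move=> /esym/eqP -> /esym/eqP ->.
Qed.

Lemma pivotsE X Y x :
  (x \in pivots X Y) =
    [&& x \notin lower (X :&: Y), x \in upper X & x \in upper Y].
Proof. by rewrite !in_set. Qed.

Lemma approx_praba_meet X Y P :
    is_transversal P (equivalence_partition R (pivots X Y)) (pivots X Y) ->
  approx (lower (X :&: Y) :|: P)
    = (lower X :&: lower Y, upper X :&: upper Y).
Proof.
case/transversal_equivP=> sP repP uniqP; set L := lower (X :&: Y).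
have LE : L = lower X :&: lower Y by apply/setP=> x; rewrite !inE subsetI.
have NR x y : R x y -> (y \in L) = (x \in L).
  by move=> Rxy; rewrite !inE (@eclass_eq x y) // inE.
have UR Z x y : R x y -> (y \in upper Z) = (x \in upper Z).
  by move=> Rxy; rewrite !inE (@eclass_eq x y) // inE.
have piv x : x \in P -> [&& x \notin L, x \in upper X & x \in upper Y].
  by rewrite -pivotsE; apply: (subsetP sP).
rewrite -LE; congr (_, _); apply/setP=> x; apply/idP/idP.
- move=> /lowerP xLP; case xL: (x \in L) => //.
  have xP y : R x y -> y \in P.
    by move=> Rxy; have := xLP y Rxy; rewrite in_setU (NR x y Rxy) xL.
  have xx y : R x y -> y = x.
    by move=> Rxy; apply/esym/uniqP; rewrite ?xP.
  have /and3P[_] := piv x (xP x (equiv_refl _ _)).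
  case/upperP=> y /xx -> xX /upperP[z /xx -> xY].
  by rewrite -xL; apply/lowerP=> t /xx ->; rewrite inE xX.
- by move=> xL; apply/lowerP=> y Rxy; rewrite in_setU (NR x y Rxy) xL.
- case/upperP=> y Rxy; rewrite in_setU => /orP[yL | /piv/and3P[_]]; last first.
    by rewrite in_setI !(UR _ x y Rxy) => -> ->.
  have := lowerP _ _ yL y (equiv_refl _ _); rewrite !in_setI => /andP[yX yY].
  by apply/andP; split; apply/upperP; exists y.
rewrite in_setI => xU; case xL: (x \in L).
  by apply/upperP; exists x; rewrite // in_setU xL.
have /repP[y yP Rxy]: x \in pivots X Y by rewrite pivotsE -/L xL.
by apply/upperP; exists y; rewrite // in_setU yP orbT.
Qed.

Lemma pivot_setP X Y :
  is_transversal (pivot_set X Y)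
    (equivalence_partition R (pivots X Y)) (pivots X Y).
Proof.
apply/transversalP/equivalence_partitionP => x y z _ _ _.
by split=> // Rxy; rewrite (equiv_ltrans Rxy).
Qed.

End PrabaOperations.

Section RoughSemiring.
Variables (U : finType) (R : equiv_rel U).
Implicit Types X Y : {set U}.

Record rough_set := RoughSet {
  approxs :> {set U} * {set U};
  _ : approxs \in codom (approx R)
}.
HB.instance Definition _ := [isSub for approxs].
HB.instance Definition _ := [Finite of rough_set by <:].
Implicit Types r s t : rough_set.

Definition RS X : rough_set := RoughSet (codom_f (approx R) X).

Definition rough_repr r : {set U} := iinv (valP r).

(* RS(X) Delta RS(Y) = RS(X Delta Y) and RS(X) Nabla RS(Y) = RS(X Nabla Y) for *)
(* arbitrary X and Y: see RS_join and RS_meet.                                 *)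
Definition rough_join r s : rough_set :=
  RS (praba_join R (rough_repr r) (rough_repr s)).
Definition rough_meet r s : rough_set :=
  RS (praba_meet R (rough_repr r) (rough_repr s)).

Definition rough_le r s : bool := (r.1 \subset s.1) && (r.2 \subset s.2).

Lemma rough_reprK : cancel rough_repr RS.
Proof. by move=> r; apply/val_inj/(f_iinv (valP r)). Qed.

Lemma approx_repr r : approx R (rough_repr r) = approxs r.
Proof. by rewrite -[in RHS](rough_reprK r). Qed.

Lemma rough_joinE r s : approxs (rough_join r s) = (r.1 :|: s.1, r.2 :|: s.2).
Proof. by rewrite /= approx_praba_join -!approx_repr. Qed.

Lemma rough_meetE r s : approxs (rough_meet r s) = (r.1 :&: s.1, r.2 :&: s.2).
Proof. by rewrite /= (approx_praba_meet (pivot_setP R _ _)) -!approx_repr. Qed.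

Lemma RS_join X Y : rough_join (RS X) (RS Y) = RS (praba_join R X Y).
Proof. by apply: val_inj; rewrite [LHS]rough_joinE [RHS]approx_praba_join. Qed.

Lemma RS_meet X Y : rough_meet (RS X) (RS Y) = RS (praba_meet R X Y).
Proof.
apply: val_inj; rewrite [LHS]rough_meetE.
by rewrite [RHS](approx_praba_meet (pivot_setP R _ _)).
Qed.

Lemma RS0E : approxs (RS set0) = (set0, set0).
Proof.
congr (_, _); apply/setP=> x; rewrite !inE; last by rewrite setI0 eqxx.
by apply/subsetP=> /(_ x (eclass_refl R x)); rewrite inE.
Qed.

Lemma RSTE : approxs (RS setT) = (setT, setT).
Proof.
congr (_, _); apply/setP=> x; rewrite !inE ?subsetT // setIT.
by apply/set0Pn; exists x; apply: eclass_refl.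
Qed.

Lemma rough_eqP r s : r.1 = s.1 -> r.2 = s.2 -> r = s.
Proof.
by move=> eq1 eq2; apply/val_inj/eqP; rewrite [val r]surjective_pairing
   [val s]surjective_pairing [(val r).1]eq1 [(val r).2]eq2.
Qed.

Fact rough_display : Order.disp_t. Proof. exact: Order.Disp tt tt. Qed.

Lemma rough_le_refl : reflexive rough_le.
Proof. by move=> r; rewrite /rough_le !subxx. Qed.

Lemma rough_le_anti : antisymmetric rough_le.
Proof.
move=> r s /andP[/andP[rs1 rs2] /andP[sr1 sr2]].
by apply: rough_eqP; apply/eqP; rewrite eqEsubset ?rs1 ?rs2.
Qed.

Lemma rough_le_trans : transitive rough_le.
Proof.
move=> s r t /andP[rs1 rs2] /andP[st1 st2].
by rewrite /rough_le (subset_trans rs1 st1) (subset_trans rs2 st2).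
Qed.

HB.instance Definition _ := Order.Le_isPOrder.Build rough_display rough_set
  rough_le_refl rough_le_anti rough_le_trans.

Lemma le_rough_meet r s t : (r <= rough_meet s t)%O = (r <= s)%O && (r <= t)%O.
Proof.
by rewrite /Order.le /= /rough_le rough_meetE /= !subsetI;
  do 4!case: (_ \subset _).
Qed.

Lemma le_rough_join r s t : (rough_join r s <= t)%O = (r <= t)%O && (s <= t)%O.
Proof.
by rewrite /Order.le /= /rough_le rough_joinE /= !subUset;
  do 4!case: (_ \subset _).
Qed.

HB.instance Definition _ := Order.POrder_MeetJoin_isLattice.Build
  rough_display rough_set le_rough_meet le_rough_join.

Lemma le0_rough r : (RS set0 <= r)%O.
Proof. by rewrite /Order.le /= /rough_le RS0E /= !sub0set. Qed.

Lemma le_rough1 r : (r <= RS setT)%O.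
Proof. by rewrite /Order.le /= /rough_le RSTE /= !subsetT. Qed.

HB.instance Definition _ := Order.hasBottom.Build rough_display rough_set
  le0_rough.
HB.instance Definition _ := Order.hasTop.Build rough_display rough_set
  le_rough1.

Lemma rough_joinA : associative rough_join. Proof. exact: joinA. Qed.
Lemma rough_joinC : commutative rough_join. Proof. exact: joinC. Qed.
Lemma rough_join0 : left_id (RS set0) rough_join. Proof. exact: join0x. Qed.
Lemma rough_meetA : associative rough_meet. Proof. exact: meetA. Qed.
Lemma rough_meetC : commutative rough_meet. Proof. exact: meetC. Qed.
Lemma rough_meet1 : left_id (RS setT) rough_meet. Proof. exact: meet1x. Qed.
Lemma rough_meet0 : left_zero (RS set0) rough_meet. Proof. exact: meet0x. Qed.
Lemma rough_meetUl : left_distributive rough_meet rough_join.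
Proof.
move=> r s t; apply: rough_eqP;
  by rewrite rough_meetE !rough_joinE !rough_meetE /= setIUl.
Qed.

HB.instance Definition _ := GRing.isNmodule.Build rough_set
  rough_joinA rough_joinC rough_join0.
HB.instance Definition _ := GRing.Nmodule_isComPzSemiRing.Build rough_set
  rough_meetA rough_meetC rough_meet1 rough_meetUl rough_meet0.

Definition is_dual_pseudocomplement r s : Prop :=
  rough_join r s = RS setT /\
  forall t, rough_join r t = RS setT -> (s <= t)%O.

End RoughSemiring.

(* Main.v *)
(** The set of [t] with [r Delta t = RS(U)] contains [RS(U)] and, since [Delta]
    distributes over [Nabla], is closed under [Nabla]; as [T] is finite, the
    meet of this set belongs to it and is therefore its least element. *)
Require Import Defs.
From mathcomp Require Import all_boot order ssralg.

Import Order.TTheory.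

(** On pairs of approximations [rough_join] and [rough_meet] are componentwise union and
    intersection, so this is distributivity of sets. *)
Lemma rough_joinIr (U : finType) (R : equiv_rel U) (r s t : rough_set R) :
  rough_join r (rough_meet s t) = rough_meet (rough_join r s) (rough_join r t).
Proof.
by apply: rough_eqP; rewrite rough_joinE !rough_meetE !rough_joinE /= setUIr.
Qed.

Lemma dual_pseudocomplement_meets (U : finType) (R : equiv_rel U)
    (r : rough_set R) :
  is_dual_pseudocomplement r (\meet_(t | rough_join r t == RS R setT) t)%O.
Proof.
split=> [|t /eqP]; last exact: (@meets_inf _ _ _ t _ id).
apply: (big_ind (fun s => rough_join r s = RS R setT)) => [|s t rs rt|t /eqP] //.
  (* The empty meet is the top element [RS R setT], which absorbs under join. *)
  exact: joinx1.
by rewrite [LHS]rough_joinIr rs rt rough_meet1.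
Qed.

(** By minimality each of [s] and [t] lies below the other, and the order is antisymmetric. *)
Lemma dual_pseudocomplement_inj (U : finType) (R : equiv_rel U)
    (r s t : rough_set R) :
  is_dual_pseudocomplement r s -> is_dual_pseudocomplement r t -> s = t.
Proof.
case=> rs min_s [rt min_t]; apply: le_anti.
by rewrite min_s ?min_t.
Qed.

Theorem theorem6 (U : finType) (U_nonempty : 0 < #|U|) (R : equiv_rel U)
    (r : rough_set R) :
  exists! s : rough_set R, is_dual_pseudocomplement r s.
Proof.
have r_meets := @dual_pseudocomplement_meets U R r.
by eexists; split=> [|t]; [exact: r_meets | exact: dual_pseudocomplement_inj].
Qed.
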